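(* For every integer $n\ge 1$, \[ \alpha_n= \begin{cases} \sqrt{\dfrac{n}{n+2}}, & n\text{ even},\\[2ex] \sqrt{\dfrac{n^2+2n-1}{(n+1)(n+3)}}, & n\text{ odd}. \end{cases} \]
   Context: For each integer $n\ge 1$, \[ \alpha_n=\sup\{d(X,Y) \mid X,Y\subseteq\mathbb{R}^n \text{ finite},\ \mathrm{diam}(X)\le 1,\ \mathrm{diam}(Y)\le 1,\ \mathrm{conv}(X)\cap\mathrm{conv}(Y)\neq\emptyset\}, \] where $d(X,Y)=\inf\{\|x-y\| : x\in X,\ y\in Y\}$ with $\|\cdot\|$ the Euclidean norm, $\mathrm{diam}(X)=\sup\{\|x-x'\| : x,x'\in X\}$, and $\mathrm{conv}$ denotes the convex hull. *)

(* Defs.v *)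
From mathcomp Require Import all_boot all_order all_algebra.
From mathcomp Require Import all_classical all_reals all_analysis.

Set Implicit Arguments.
Unset Strict Implicit.
Unset Printing Implicit Defensive.

Import Order.TTheory GRing.Theory Num.Theory.

Local Open Scope classical_set_scope.
Local Open Scope ring_scope.

(* The library norm `|x| on row vectors is the maximum norm, hence a separate
   Euclidean norm. *)
Definition enorm (R : realType) (n : nat) (x : 'rV[R]_n) : R :=
  Num.sqrt (\sum_(i < n) x ord0 i ^+ 2).

Definition diam (R : realType) (n : nat) (X : set 'rV[R]_n) : R :=
  sup [set r | exists x x', [/\ X x, X x' & r = enorm (x - x')]].

Definition set_dist (R : realType) (n : nat) (X Y : set 'rV[R]_n) : R :=
  inf [set r | exists x y, [/\ X x, Y y & r = enorm (x - y)]].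

Definition convex_hull (R : realType) (n : nat) (X : set 'rV[R]_n) :
    set 'rV[R]_n :=
  smallest (@convex_set R 'rV[R]_n) X.

(* [sup] and [inf] are real-valued, with value 0 on sets that are empty or
   unbounded.  This plays no role here: two sets whose hulls meet are nonempty,
   a finite set has finite diameter, and the admissible distances form a
   nonempty set bounded by 2. *)
Definition alpha (R : realType) (n : nat) : R :=
  sup [set r | exists X Y : set 'rV[R]_n,
    [/\ finite_set X /\ finite_set Y, diam X <= 1, diam Y <= 1,
        convex_hull X `&` convex_hull Y !=set0 & r = set_dist X Y]].

(* Main.v *)
Require Import Defs.
From mathcomp Require Import all_boot all_order all_algebra.
From mathcomp Require Import all_classical all_reals all_analysis.
From mathcomp Require Import zify ring lra.

(** Upper bound.  Suppose conv X and conv Y share a point z, and write z as a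
    convex combination of X with weights a and of Y with weights b.  Lift the
    points x of X to (x, 1, 0) and the points y of Y to (-y, 0, 1): then the
    pair (a, b) is a conic combination of lifted vectors equal to (0, 1, 1),
    and Caratheodory's theorem for cones in dimension n + 2 gives weights with
    supports of sizes p and q, p + q <= n + 2 ([joint_caratheodory]).

    Now average the squared distance |x - y|^2 over independent x ~ a and
    y ~ b.  Since both distributions have mean z, this average is
    Var a + Var b, and Var a is half the average of |x - x'|^2 over
    independent x, x' ~ a ([mean_sqdist_common_mean]).  When diam X <= 1 the
    latter average is at most the probability that x and x' have different
    indices, 1 - sum_i a_i^2, hence at most 1 - 1/p
    ([mean_sqdist_diag_le]).  So some pair satisfies
    |x - y|^2 <= 1 - (1/p + 1/q) / 2, and under p + q <= n + 2 the right-hand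
    side is largest when p and q are as equal as possible
    ([inv_sum_balanced]).

    Lower bound.  Every inequality above is an equality for two regular
    simplices of edge 1 and dimensions m1 and m2, m1 + m2 = n, lying in
    orthogonal subspaces and sharing their centroid ([orthogonal_simplices]).
    With p = m1 + 1 and q = m2 + 1, the choice m1 = m2 for even n and
    m2 = m1 + 1 for odd n gives the two formulas.

    A finite set of points is handled throughout as the set of rows of a
    matrix, so that convex combinations are products a *m X with a row vector
    of weights. *)

Import Order.TTheory GRing.Theory Num.Theory.

Set Implicit Arguments.
Unset Strict Implicit.
Unset Printing Implicit Defensive.

Local Open Scope classical_set_scope.
Local Open Scope ring_scope.

(** * Caratheodory's theorem *)

Definition wsupport (F : realFieldType) (N : nat) (w : 'rV[F]_N) : {set 'I_N} :=
  [set i | w 0 i != 0].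

(** More than [k] rows of a matrix with [k] columns are linearly dependent; a
    relation between them, or its opposite, has a negative coefficient.  The
    negative coefficient is what lets a nonnegative combination be moved along
    the relation until one of its weights vanishes. *)
Lemma left_kernel_wsupport (F : realFieldType) (N k : nat) (A : 'M[F]_(N, k))
    (S : {set 'I_N}) : (k < #|S|)%N ->
  exists c : 'rV[F]_N,
    [/\ c *m A = 0, {in ~: S, forall i, c 0 i = 0} & exists i, c 0 i < 0].
Proof.
move=> ltkS; pose f (j : 'I_#|S|) : 'I_N := enum_val j.
have : kermx (rowsub f A) != 0.
  rewrite kermx_eq0 /row_free neq_ltn.
  by rewrite (leq_ltn_trans (rank_leq_col _) ltkS).
case/rowV0Pn => u /sub_kermxP uA /rV0Pn[j uj].
(* Extend the relation u on the rows in S by zero outside S. *)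
pose c : 'rV[F]_N := u *m rowsub f 1%:M.
have cE i : c 0 i = \sum_l u 0 l * (f l == i)%:R.
  by rewrite mxE; apply: eq_bigr => l _; rewrite !mxE.
have cfj : c 0 (f j) = u 0 j.
  rewrite cE (bigD1 j) //= eqxx mulr1 big1 ?addr0 // => l lj.
  by rewrite (inj_eq enum_val_inj) (negPf lj) mulr0.
have cA : c *m A = 0 by rewrite -mulmxA mul_rowsub_mx mul1mx.
have cS : {in ~: S, forall i, c 0 i = 0}.
  move=> i; rewrite inE => iS; rewrite cE big1 // => l _.
  case: eqP => [fl|_]; last by rewrite mulr0.
  by rewrite -fl enum_valP in iS.
have [cneg|cpos] := ltP (c 0 (f j)) 0.
  by exists c; split=> //; exists (f j).
exists (- c); split.
- by rewrite mulNmx cA oppr0.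
- by move=> i iS; rewrite mxE cS // oppr0.
- by exists (f j); rewrite mxE oppr_lt0 lt0r cpos cfj uj.
Qed.

(** While more than [k] weights are nonzero, add to [w] the largest multiple of
    a linear relation that keeps all weights nonnegative: the weighted sum is
    unchanged and at least one weight becomes zero. *)
Lemma conic_caratheodory (F : realFieldType) (N k : nat) (A : 'M[F]_(N, k))
    (w : 'rV[F]_N) : (forall i, 0 <= w 0 i) ->
  exists w' : 'rV[F]_N,
    [/\ forall i, 0 <= w' 0 i, w' *m A = w *m A & (#|wsupport w'| <= k)%N].
Proof.
have [m] := ubnP #|wsupport w|; elim: m w => // m IH w; rewrite ltnS => lem w0.
have [|ltk] := leqP #|wsupport w| k; first by exists w.
have [c [cA cS [i0 ci0]]] := left_kernel_wsupport A ltk.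
case: (@arg_minP _ _ _ i0 (fun i => c 0 i < 0) (fun i => w 0 i / - c 0 i) ci0).
move=> i ci imin; pose t := w 0 i / - c 0 i.
have t0 : 0 <= t by rewrite divr_ge0 // oppr_ge0 ltW.
have wtc j : (w + t *: c) 0 j = w 0 j + t * c 0 j by rewrite !mxE.
have [|j|w' [w'0 w'A w'k]] := IH (w + t *: c).
- apply: leq_trans lem; apply: proper_card; apply/properP; split.
    apply/fintype.subsetP => j; rewrite !inE wtc; apply: contra => /eqP wj.
    by rewrite wj add0r cS ?mulr0 // !inE wj eqxx.
  exists i; last by rewrite inE wtc negbK /t; apply/eqP; field; rewrite lt_eqF.
  by apply: contraT => iS; rewrite cS ?ltxx // inE in ci.
- rewrite wtc; have [cj|cj] := ltP (c 0 j) 0; last first.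
    by rewrite addr_ge0 // mulr_ge0.
  by have := imin j cj; rewrite ler_pdivlMr ?oppr_gt0 // mulrN -subr_ge0 opprK.
- by exists w'; split=> //; rewrite w'A mulmxDl -scalemxAl cA scaler0 addr0.
Qed.

Definition weights (F : realFieldType) (p : nat) (a : 'rV[F]_p) : Prop :=
  (forall i, 0 <= a 0 i) /\ \sum_i a 0 i = 1.

Lemma card_wsupport_row_mx (F : realFieldType) (p q : nat) (a : 'rV[F]_p)
    (b : 'rV[F]_q) :
  #|wsupport (row_mx a b)| = (#|wsupport a| + #|wsupport b|)%N.
Proof.
rewrite -!sum1_card big_split_ord /=.
by congr addn; apply: eq_bigl => i; rewrite !inE ?row_mxEl ?row_mxEr.
Qed.

(** Two convex combinations of the same point form one conic combination, in
    dimension [n + 2], of the rows of the block matrix below: the first [n]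
    columns record that the two points agree, and each of the last two that
    one of the families of weights has total 1. *)
Lemma joint_caratheodory (F : realFieldType) (n p q : nat)
    (X : 'M[F]_(p, n)) (Y : 'M[F]_(q, n)) (a : 'rV[F]_p) (b : 'rV[F]_q) :
  weights a -> weights b -> a *m X = b *m Y ->
  exists (a' : 'rV[F]_p) (b' : 'rV[F]_q),
    [/\ weights a', weights b', a' *m X = b' *m Y
    & (#|wsupport a'| + #|wsupport b'| <= n + 2)%N].
Proof.
move=> [a0 a1] [b0 b1] ab.
pose one r : 'cV[F]_r := const_mx 1.
have mul_one r (c : 'rV[F]_r) : c *m one r = (\sum_i c 0 i)%:M.
  apply/matrixP => i j; rewrite !ord1 !mxE eqxx mulr1n.
  by apply: eq_bigr => l _; rewrite mxE mulr1.
pose A : 'M[F]_(p + q, n + (1 + 1)) :=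
  block_mx X (row_mx (one p) 0) (- Y) (row_mx 0 (one q)).
have mulA (c : 'rV[F]_p) (d : 'rV[F]_q) : row_mx c d *m A =
    row_mx (c *m X - d *m Y)
      (row_mx (\sum_i c 0 i)%:M (\sum_i d 0 i)%:M).
  rewrite mul_row_block !mul_mx_row !mulmx0 add_row_mx addr0 add0r mulmxN.
  by rewrite !mul_one.
have [i|w [w0 wA wk]] := @conic_caratheodory _ _ _ A (row_mx a b).
  rewrite -(splitK i); case: (fintype.split i) => j;
    by rewrite ?row_mxEl ?row_mxEr.
rewrite -[w]hsubmxK in w0 wA wk.
exists (lsubmx w), (rsubmx w); move: wA; rewrite !mulA ab subrr a1 b1.
case/eq_row_mx => /eqP; rewrite subr_eq0 => /eqP ab' /eq_row_mx[sa sb].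
have scal (x : F) : x%:M = (1%:M : 'M[F]_1) -> x = 1.
  by move=> /matrixP/(_ 0 0); rewrite !mxE eqxx !mulr1n.
split=> //; last by rewrite -card_wsupport_row_mx.
- by split=> [i|]; [have := w0 (lshift q i); rewrite row_mxEl | exact: scal].
- by split=> [i|]; [have := w0 (rshift p i); rewrite row_mxEr | exact: scal].
Qed.

(** * Mean squared distances *)

Definition sqnorm (F : realFieldType) (n : nat) (v : 'rV[F]_n) : F :=
  \sum_k v 0 k ^+ 2.

Definition mean_sqdist (F : realFieldType) (n p q : nat) (a : 'rV[F]_p)
    (b : 'rV[F]_q) (X : 'M[F]_(p, n)) (Y : 'M[F]_(q, n)) : F :=
  \sum_i \sum_j a 0 i * b 0 j * sqnorm (row i X - row j Y).

Lemma mean_sqdistE (F : realFieldType) (n p q : nat) (a : 'rV[F]_p)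
    (b : 'rV[F]_q) (X : 'M[F]_(p, n)) (Y : 'M[F]_(q, n)) :
  \sum_i a 0 i = 1 -> \sum_j b 0 j = 1 ->
  mean_sqdist a b X Y =
    \sum_k (\sum_i a 0 i * X i k ^+ 2 + \sum_j b 0 j * Y j k ^+ 2
            - 2 * ((a *m X) 0 k * (b *m Y) 0 k)).
Proof.
move=> a1 b1; rewrite /mean_sqdist.
transitivity (\sum_k \sum_i \sum_j a 0 i * b 0 j * (X i k - Y j k) ^+ 2).
  rewrite [RHS]exchange_big; apply: eq_bigr => i _; rewrite [RHS]exchange_big.
  apply: eq_bigr => j _; rewrite mulr_sumr; apply: eq_bigr => k _.
  by rewrite !mxE.
apply: eq_bigr => k _; rewrite !mxE.
transitivity (\sum_i (a 0 i * X i k ^+ 2 * (\sum_j b 0 j)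
   + a 0 i * (\sum_j b 0 j * Y j k ^+ 2)
   - 2 * (a 0 i * X i k * (\sum_j b 0 j * Y j k)))).
  apply: eq_bigr => i _; rewrite !mulr_sumr -big_split -sumrB /=.
  by apply: eq_bigr => j _; ring.
rewrite sumrB big_split /= b1 -mulr_sumr -!mulr_suml a1 mul1r.
by rewrite !mulr1.
Qed.

(** Both sides are the sum of the two variances: in [mean_sqdistE] the last
    term is the inner product of the means, the same for all three averages. *)
Lemma mean_sqdist_common_mean (F : realFieldType) (n p q : nat)
    (a : 'rV[F]_p) (b : 'rV[F]_q) (X : 'M[F]_(p, n)) (Y : 'M[F]_(q, n)) :
  \sum_i a 0 i = 1 -> \sum_j b 0 j = 1 -> a *m X = b *m Y ->
  mean_sqdist a b X Y = (mean_sqdist a a X X + mean_sqdist b b Y Y) / 2.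
Proof.
move=> a1 b1 ab; rewrite !mean_sqdistE // ab -big_split /= mulr_suml.
by apply: eq_bigr => k _; field.
Qed.

Lemma sum_wsupport (F : realFieldType) (p : nat) (a : 'rV[F]_p) (f : F -> F) :
  f 0 = 0 -> \sum_i f (a 0 i) = \sum_(i in wsupport a) f (a 0 i).
Proof.
move=> f0; rewrite [RHS]big_mkcond; apply: eq_bigr => i _.
by rewrite inE; case: eqP => // ->.
Qed.

Lemma card_wsupport_gt0 (F : realFieldType) (p : nat) (a : 'rV[F]_p) :
  \sum_i a 0 i = 1 -> (0 < #|wsupport a|)%N.
Proof.
move=> a1; rewrite lt0n; apply/negP => /eqP/cards0_eq s0.
have /eqP := a1; rewrite (@sum_wsupport _ _ a id) // s0 big_set0.
by rewrite eq_sym oner_eq0.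
Qed.

(** Expand the sum of the [(a_i - 1/N) ^ 2] over the support, where [N] is its
    size; this sum of squares is the defect in the Cauchy-Schwarz inequality. *)
Lemma sum_sqr_weights_ge (F : realFieldType) (p : nat) (a : 'rV[F]_p) :
  \sum_i a 0 i = 1 -> #|wsupport a|%:R^-1 <= \sum_i a 0 i ^+ 2.
Proof.
move=> a1; set N : F := #|wsupport a|%:R.
have N0 : N != 0 by rewrite pnatr_eq0 -lt0n card_wsupport_gt0.
have : 0 <= \sum_(i in wsupport a) (a 0 i - N^-1) ^+ 2.
  by apply: sumr_ge0 => i _; exact: sqr_ge0.
have -> : \sum_(i in wsupport a) (a 0 i - N^-1) ^+ 2 =
    \sum_i a 0 i ^+ 2 - N^-1.
  transitivity (\sum_(i in wsupport a)
     (a 0 i ^+ 2 - 2 * N^-1 * a 0 i + N^-1 ^+ 2)).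
    by apply: eq_bigr => i _; ring.
  rewrite big_split sumrB /= -mulr_sumr -(@sum_wsupport _ _ a id) // a1.
  rewrite -(@sum_wsupport _ _ a (fun x => x ^+ 2)) ?expr0n //.
  by rewrite sumr_const -mulr_natl -/N; field.
by rewrite subr_ge0.
Qed.

(** The diagonal terms vanish and the others are bounded by [a_i * a_j], which
    leaves the probability [1 - sum_i a_i ^ 2] of drawing two different
    indices. *)
Lemma mean_sqdist_diag_le (F : realFieldType) (n p : nat) (a : 'rV[F]_p)
    (X : 'M[F]_(p, n)) :
  weights a -> (forall i j, sqnorm (row i X - row j X) <= 1) ->
  mean_sqdist a a X X <= 1 - #|wsupport a|%:R^-1.
Proof.
move=> [a0 a1] X1; apply: (@le_trans _ _ (1 - \sum_i a 0 i ^+ 2)); last first.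
  by rewrite lerB // sum_sqr_weights_ge.
have -> : 1 - \sum_i a 0 i ^+ 2 =
    \sum_i \sum_j (a 0 i * a 0 j * (i != j)%:R).
  rewrite -{1}(mulr1 1) -{1}a1 mulr_suml -sumrB; apply: eq_bigr => i _.
  rewrite -{1}a1 mulr_sumr [in RHS](bigD1 i) //= eqxx mulr0 add0r.
  rewrite (bigD1 i) //= expr2 addrAC subrr add0r; apply: eq_bigr => j ji.
  by rewrite eq_sym ji mulr1.
apply: ler_sum => i _; apply: ler_sum => j _; apply: ler_wpM2l.
  by rewrite mulr_ge0.
case: eqP => [->|_] //=; rewrite subrr /sqnorm big1 // => k _.
by rewrite mxE expr0n.
Qed.

(** A lower bound for all the distances is a lower bound for their average. *)
Lemma sqdist_le (F : realFieldType) (n p q : nat) (X : 'M[F]_(p, n))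
    (Y : 'M[F]_(q, n)) (a : 'rV[F]_p) (b : 'rV[F]_q) (d : F) :
  weights a -> weights b -> a *m X = b *m Y ->
  (forall i j, sqnorm (row i X - row j X) <= 1) ->
  (forall i j, sqnorm (row i Y - row j Y) <= 1) ->
  (forall i j, d <= sqnorm (row i X - row j Y)) ->
  d <= 1 - (#|wsupport a|%:R^-1 + #|wsupport b|%:R^-1) / 2.
Proof.
move=> wa wb ab X1 Y1 dXY.
have dle : d <= mean_sqdist a b X Y.
  have -> : d = \sum_i \sum_j a 0 i * b 0 j * d.
    under eq_bigr do rewrite -mulr_suml -mulr_sumr wb.2 mulr1.
    by rewrite -mulr_suml wa.2 mul1r.
  apply: ler_sum => i _; apply: ler_sum => j _.
  by rewrite ler_wpM2l // mulr_ge0 ?wa.1 ?wb.1.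
have Ma := mean_sqdist_diag_le wa X1; have Mb := mean_sqdist_diag_le wb Y1.
move: dle; rewrite mean_sqdist_common_mean ?wa.2 ?wb.2 //; lra.
Qed.

(** Among positive integers with bounded sum, the sum of inverses is smallest
    for the balanced pair: enlarge [p] until the sums agree; then only the
    products matter, and [P * Q - p * q = (P - q) * (Q - q)] is nonnegative
    because no integer lies strictly between [P] and [Q]. *)
Lemma inv_sum_balanced (F : realFieldType) (p q P Q : nat) :
  (0 < p)%N -> (0 < q)%N -> (p + q <= P + Q)%N -> (P <= Q <= P.+1)%N ->
  P%:R^-1 + Q%:R^-1 <= p%:R^-1 + q%:R^-1 :> F.
Proof.
move=> p0 q0 pq PQ.
have [p' [pp' p'q]] : exists p', (p <= p')%N /\ (p' + q = P + Q)%N.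
  by exists (P + Q - q)%N; lia.
apply: (@le_trans _ _ (p'%:R^-1 + q%:R^-1)); last first.
  by rewrite lerD2r lef_pV2 ?ler_nat ?posrE ?ltr0n //; lia.
have P0 : (0 < P)%N by lia.
have Q0 : (0 < Q)%N by lia.
have sumV (x y : nat) : (0 < x)%N -> (0 < y)%N ->
    x%:R^-1 + y%:R^-1 = (x + y)%:R / (x * y)%:R :> F.
  by move=> x0 y0; rewrite natrM natrD; field; rewrite !pnatr_eq0; lia.
rewrite !sumV //; last by lia.
rewrite p'q ler_wpM2l // lef_pV2 ?posrE ?ltr0n ?muln_gt0 ?P0 ?Q0 ?q0 ?andbT //;
  last by lia.
rewrite ler_nat.
have [qP|qP] := leqP q P; nia.
Qed.

(** * Convex hulls and distances of finite point sets *)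

Lemma enormE (R : realType) (n : nat) (v : 'rV[R]_n) :
  enorm v = Num.sqrt (sqnorm v).
Proof. by []. Qed.

Definition row_set (T : Type) (p n : nat) (X : 'M[T]_(p, n)) : set 'rV[T]_n :=
  [set row i X | i in setT].

Lemma row_setP (T : Type) (p n : nat) (X : 'M[T]_(p, n)) (i : 'I_p) :
  row_set X (row i X).
Proof. by exists i. Qed.

Lemma finite_set_rows (R : realType) (n : nat) (A : set 'rV[R]_n) :
  finite_set A -> exists p (X : 'M[R]_(p, n)), A = row_set X.
Proof.
move=> /finite_seqP[s ->]; exists (size s), (\matrix_(i < size s) s`_i).
apply/seteqP; split=> v /=.
  move=> vs; have ltvs : (index v s < size s)%N by rewrite index_mem.
  by exists (Ordinal ltvs) => //; rewrite rowK /= nth_index.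
by move=> [i _ <-]; rewrite rowK mem_nth.
Qed.

Lemma convex_hull_rows (R : realType) (p n : nat) (X : 'M[R]_(p, n))
    (z : 'rV[R]_n) :
  convex_hull (row_set X) z -> exists2 a, weights a & z = a *m X.
Proof.
apply: (@smallest_sub _ _ _ [set z | exists2 a, weights a & z = a *m X]).
  move=> x y l; rewrite !inE /= => -[a [a0 a1] ->] [b [b0 b1] ->].
  exists (l%:num *: a + (1 - l%:num) *: b); last first.
    by rewrite mulmxDl -!scalemxAl.
  split=> [i|]; first by rewrite !mxE addr_ge0 // mulr_ge0 // subr_ge0.
  under eq_bigr do rewrite !mxE.
  by rewrite big_split /= -!mulr_sumr a1 b1 !mulr1 addrC subrK.
move=> _ [i _ <-] /=; exists (delta_mx 0 i); last by rewrite -rowE.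
split=> [j|]; first by rewrite mxE; case: (_ && _).
rewrite (bigD1 i) //= mxE !eqxx big1 ?addr0 // => j ji.
by rewrite mxE (negPf ji) andbF.
Qed.

(** Adding one point moves the centroid of [k + 1] points to the combination
    with coefficients [(k + 1) / (k + 2)] and [1 / (k + 2)]. *)
Lemma convex_set_centroid (R : realType) (n : nat) (C : set 'rV[R]_n)
    (v : nat -> 'rV[R]_n) (k : nat) :
  convex_set C -> (forall i, (i <= k)%N -> C (v i)) ->
  C (k.+1%:R^-1 *: \sum_(i < k.+1) v i).
Proof.
move=> convC; elim: k => [|k IH] Cv.
  by rewrite big_ord1 invr1 scale1r; exact: Cv.
have l0 : 0 <= k.+1%:R / k.+2%:R :> R by rewrite divr_ge0.
have l1 : k.+1%:R / k.+2%:R <= 1 :> R.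
  by rewrite ler_pdivrMr ?ltr0n // mul1r ler_nat.
have Ck : C (k.+1%:R^-1 *: \sum_(i < k.+1) v i).
  by apply: IH => i ik; apply: Cv; exact: leqW.
have := convC _ _ (Itv01 l0 l1) (mem_set Ck) (mem_set (Cv k.+1 (leqnn _))).
move/set_mem; congr C; rewrite /conv /= scalerA [in RHS]big_ord_recr /=.
rewrite scalerDr mulrAC divff ?pnatr_eq0 // mul1r; congr (_ + _ *: _).
have k2 : k.+2%:R != 0 :> R by rewrite pnatr_eq0.
by rewrite /unstable.onem -{1}(addrK 1 k.+1%:R) natr1; field.
Qed.

Lemma convex_hull_centroid (R : realType) (p n : nat) (X : 'M[R]_(p.+1, n)) :
  convex_hull (row_set X) (p.+1%:R^-1 *: (const_mx 1 *m X)).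
Proof.
move=> C [convC XC].
have -> : const_mx 1 *m X = \sum_(i < p.+1) row (inord i) X.
  rewrite mulmx_sum_row; apply: eq_bigr => i _.
  by rewrite mxE scale1r inord_val.
apply: (@convex_set_centroid _ _ C (fun i => row (inord i) X) p convC) => i _.
exact/XC/row_setP.
Qed.

Lemma sqnorm_le_diam (R : realType) (p n : nat) (X : 'M[R]_(p, n)) :
  diam (row_set X) <= 1 ->
  forall i j, sqnorm (row i X - row j X) <= 1.
Proof.
move=> diam1 i j; rewrite -(ler_sqrt _ ler01) sqrtr1 -enormE.
apply: le_trans diam1; apply: ub_le_sup; last first.
  by exists (row i X), (row j X); split=> //; [exists i | exists j].
(* The supremum only dominates its elements once the set is known to be
   bounded; the sum of all distances is a crude bound. *)
exists (\sum_k \sum_l enorm (row k X - row l X)).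
move=> _ [_ [_ [[k _ <-] [l _ <-] ->]]].
have e0 v : 0 <= enorm v :> R := sqrtr_ge0 _.
rewrite (bigD1 k) //= (bigD1 l) //= -addrA lerDl addr_ge0 ?sumr_ge0 //.
by move=> k' _; exact: sumr_ge0.
Qed.

Lemma set_dist_le (R : realType) (n : nat) (A B : set 'rV[R]_n)
    (x y : 'rV[R]_n) : A x -> B y -> set_dist A B <= enorm (x - y).
Proof.
move=> Ax By; apply: ge_inf; last by exists x, y.
by exists 0 => _ [? [? [_ _ ->]]]; exact: sqrtr_ge0.
Qed.

(** The sizes [p] and [q] are those of the supports of the reduced
    convex combinations of a common point of the two hulls. *)
Lemma set_dist_upper (R : realType) (n : nat) (A B : set 'rV[R]_n) :
  finite_set A -> finite_set B -> diam A <= 1 -> diam B <= 1 ->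
  convex_hull A `&` convex_hull B !=set0 ->
  exists p q : nat, [/\ (0 < p)%N, (0 < q)%N, (p + q <= n + 2)%N
    & set_dist A B <= Num.sqrt (1 - (p%:R^-1 + q%:R^-1) / 2)].
Proof.
move=> /finite_set_rows[r [X ->]] /finite_set_rows[s [Y ->]].
move=> /sqnorm_le_diam X1 /sqnorm_le_diam Y1.
move=> [z [/convex_hull_rows[a0 wa0 za0] /convex_hull_rows[b0 wb0 zb0]]].
rewrite {}za0 in zb0.
have [a [b [wa wb ab card_ab]]] := joint_caratheodory wa0 wb0 zb0.
exists #|wsupport a|, #|wsupport b|.
split=> //; [ exact: card_wsupport_gt0 wa.2 | exact: card_wsupport_gt0 wb.2 |].
set d := set_dist _ _; have [d0|d0] := leP 0 d; last first.
  exact: le_trans (ltW d0) (sqrtr_ge0 _).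
have dXY i j : d ^+ 2 <= sqnorm (row i X - row j Y).
  have s0 : 0 <= sqnorm (row i X - row j Y).
    by apply: sumr_ge0 => k _; exact: sqr_ge0.
  rewrite -(sqr_sqrtr s0) ler_pXn2r ?nnegrE ?sqrtr_ge0 // -enormE.
  by apply: set_dist_le; [exists i | exists j].
have d2 := sqdist_le wa wb ab X1 Y1 dXY.
by rewrite -(ger0_norm d0) -sqrtr_sqr ler_wsqrtr.
Qed.

(** * Regular simplices in orthogonal subspaces *)

(** A regular simplex with centroid 0, circumscribed radius
    [sqrt (m / (m + 1))] and edge [sqrt 2], described by its Gram matrix.  Its
    vertices are [e_i - s (1, ..., 1)] for [i < m], and [- t (1, ..., 1)]; the
    centroid is 0 when [m s = 1 - t], and the last vertex has the right norm
    when [t ^ 2 = 1 / (m + 1)]. *)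
Lemma regular_simplex_exists (F : rcfType) (m : nat) :
  exists V : 'M[F]_(m.+1, m),
    V *m V^T = 1%:M - const_mx m.+1%:R^-1 /\ const_mx 1 *m V = 0 :> 'rV[F]_m.
Proof.
pose t : F := Num.sqrt m.+1%:R^-1; pose s : F := (1 - t) / m%:R.
have t2 : t ^+ 2 = m.+1%:R^-1 by rewrite sqr_sqrtr // invr_ge0.
have mt2 : m%:R * t ^+ 2 = 1 - t ^+ 2.
  by rewrite t2 -natr1; field; rewrite natr1 pnatr_eq0.
have ms : m%:R * s = 1 - t.
  (* For m = 0, where s = 0 by convention, the equation requires t = 1. *)
  rewrite /s; have [m0|m0] := eqVneq (m%:R : F) 0; last by field.
  have t21 : t ^+ 2 = 1 by rewrite t2 -natr1 m0 add0r invr1.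
  have /eqP := t21; rewrite sqrf_eq1 => /orP[/eqP->|/eqP tN1].
    by rewrite m0 mul0r subrr.
  by have := sqrtr_ge0 (m.+1%:R^-1 : F); rewrite -/t tN1 oppr_ge0 ler10.
have const_mul p q (a b : F) :
    (const_mx a : 'M[F]_(p, m)) *m (const_mx b : 'M[F]_(m, q)) =
    const_mx (m%:R * (a * b)).
  apply/matrixP => i j; rewrite !mxE; under eq_bigr do rewrite !mxE.
  by rewrite sumr_const card_ord mulr_natl.
have t2' : t ^+ 2 = (m + 1)%:R^-1 by rewrite addn1.
rewrite -addn1.
exists (col_mx (1%:M - const_mx s) (const_mx (- t))); split; last first.
  rewrite -row_mx_const mul_row_col mulmxBr mulmx1 const_mul.
  apply/matrixP => i j; rewrite !mxE big_ord1 !mxE mul1r mul1r ms; ring.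
rewrite tr_col_mx mul_col_row linearB /= trmx1 !trmx_const.
rewrite scalar_mx_block -block_mx_const opp_block_mx add_block_mx -t2'.
congr block_mx; rewrite ?mulmxBl ?mulmxBr ?mul1mx ?mulmx1 ?const_mul;
  apply/matrixP => i j; rewrite !mxE ?sub0r ?mulr1n.
- have -> : m%:R * (s * s) = (1 - t) * s by rewrite mulrA ms.
  have -> : t ^+ 2 = s * (1 + t); last by ring.
  have [m0|m0] := eqVneq (m%:R : F) 0; last first.
    by apply: (mulfI m0); rewrite mt2 mulrA ms; ring.
  by case: (m) m0 i j => [|k] /eqP; [move=> _ [] | rewrite pnatr_eq0].
- by rewrite mulrN mulrN mulrA ms; ring.
- by rewrite mulNr mulrN mulrCA ms; ring.
- by rewrite mulrNN -expr2 mt2 !ord1 eqxx.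
Qed.

Lemma sqnorm_row_sub (F : realFieldType) (n p q : nat) (X : 'M[F]_(p, n))
    (Y : 'M[F]_(q, n)) i j :
  sqnorm (row i X - row j Y) =
    (X *m X^T) i i + (Y *m Y^T) j j - 2 * (X *m Y^T) i j.
Proof.
rewrite !mxE mulr_sumr -big_split -sumrB /=.
by apply: eq_bigr => k _; rewrite !mxE; ring.
Qed.

(** The factor [c = sqrt (1 / 2)] brings the edges from [sqrt 2] to 1.  By
    orthogonality, the squared distance of vertices of different simplices is
    the sum of the squared radii [m1 / (2 (m1 + 1))] and
    [m2 / (2 (m2 + 1))]. *)
Lemma orthogonal_simplices (F : rcfType) (m1 m2 : nat) :
  exists (X : 'M[F]_(m1.+1, m1 + m2)) (Y : 'M[F]_(m2.+1, m1 + m2)),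
    [/\ forall i j, sqnorm (row i X - row j X) <= 1,
        forall i j, sqnorm (row i Y - row j Y) <= 1,
        forall i j, sqnorm (row i X - row j Y) =
          1 - (m1.+1%:R^-1 + m2.+1%:R^-1) / 2,
        const_mx 1 *m X = 0 :> 'rV[F]_(m1 + m2)
      & const_mx 1 *m Y = 0 :> 'rV[F]_(m1 + m2)].
Proof.
have [V [VV V0]] := regular_simplex_exists F m1.
have [W [WW W0]] := regular_simplex_exists F m2.
pose c : F := Num.sqrt 2^-1.
have c2 : c * c = 2^-1 by rewrite -expr2 sqr_sqrtr // invr_ge0.
exists (row_mx (c *: V) 0), (row_mx 0 (c *: W)).
have scaleT p q (A : 'M[F]_(p, q)) :
    (c *: A) *m (c *: A)^T = 2^-1 *: (A *m A^T).
  by rewrite linearZ /= -scalemxAl -scalemxAr scalerA c2.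
split=> [i j|i j|i j||].
- rewrite sqnorm_row_sub tr_row_mx mul_row_col scaleT VV trmx0 mulmx0 addr0.
  rewrite !mxE !eqxx !mulr1n; case: eqP => _ /=; rewrite ?mulr1n ?mulr0n;
    move: (m1.+1%:R^-1) => x; lra.
- rewrite sqnorm_row_sub tr_row_mx mul_row_col scaleT WW trmx0 mulmx0 add0r.
  rewrite !mxE !eqxx !mulr1n; case: eqP => _ /=; rewrite ?mulr1n ?mulr0n;
    move: (m2.+1%:R^-1) => x; lra.
- rewrite sqnorm_row_sub !tr_row_mx !mul_row_col !scaleT VV WW !trmx0.
  rewrite !mulmx0 !mul0mx !addr0 add0r !mxE !eqxx !mulr1n.
  by move: (m1.+1%:R^-1) (m2.+1%:R^-1) => x y; field.
- by rewrite mul_mx_row -scalemxAr V0 scaler0 mulmx0 row_mx0.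
- by rewrite mul_mx_row -scalemxAr W0 scaler0 mulmx0 row_mx0.
Qed.

Lemma diam_row_set_le1 (R : realType) (p n : nat) (X : 'M[R]_(p.+1, n)) :
  (forall i j, sqnorm (row i X - row j X) <= 1) -> diam (row_set X) <= 1.
Proof.
move=> X1; apply: ge_sup.
  by exists (enorm (row 0 X - row 0 X)), (row 0 X), (row 0 X); split=> //;
    exact: row_setP.
move=> _ [_ [_ [[i _ <-] [j _ <-] ->]]].
by rewrite enormE -[leRHS]sqrtr1 ler_wsqrtr.
Qed.

(** The vertex sets of the two simplices are admissible since the common
    centroid lies in both hulls, and their distance is that of any pair of
    vertices. *)
Lemma set_dist_attained (R : realType) (m1 m2 : nat) :
  exists A B : set 'rV[R]_(m1 + m2),
    [/\ finite_set A /\ finite_set B, diam A <= 1, diam B <= 1,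
        convex_hull A `&` convex_hull B !=set0
      & Num.sqrt (1 - (m1.+1%:R^-1 + m2.+1%:R^-1) / 2) = set_dist A B].
Proof.
have [X [Y [X1 Y1 XY X0 Y0]]] := orthogonal_simplices R m1 m2.
exists (row_set X), (row_set Y); split.
- by split; apply: finite_image; exact: finite_finset.
- exact: diam_row_set_le1.
- exact: diam_row_set_le1.
- exists 0.
  have := (@convex_hull_centroid _ _ _ X, @convex_hull_centroid _ _ _ Y).
  by rewrite X0 Y0 !scaler0 => -[].
rewrite /set_dist -[LHS]inf1; congr inf; apply/seteqP; split=> r /=.
  move=> ->; exists (row 0 X), (row 0 Y).
  by split; [exact: row_setP | exact: row_setP | rewrite enormE XY].
by move=> [_ [_ [[i _ <-] [j _ <-] ->]]]; rewrite enormE XY.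
Qed.

(** * The value of the supremum *)

Lemma alpha_balanced (R : realType) (m1 m2 : nat) : (m1 <= m2 <= m1.+1)%N ->
  alpha R (m1 + m2) = Num.sqrt (1 - (m1.+1%:R^-1 + m2.+1%:R^-1) / 2).
Proof.
move=> m12; rewrite /alpha; set S := [set r | _]; set v := Num.sqrt _.
have Sv : S v := set_dist_attained R m1 m2.
have ubv : ubound S v.
  move=> _ [A [B [[finA finB] dA dB AB ->]]].
  have [p [q [p0 q0 pq /le_trans]]] := set_dist_upper finA finB dA dB AB.
  apply; apply: ler_wsqrtr; rewrite lerB // ler_wpM2r ?invr_ge0 //.
  by apply: inv_sum_balanced => //; lia.
apply/eqP; rewrite eq_le; apply/andP; split.
  by apply: ge_sup => //; exists v.
by apply: ub_le_sup => //; exists v.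
Qed.

Unset Implicit Arguments.

Theorem lemma4p2 (R : realType) (n : nat) (n_ge1 : (1 <= n)%N) :
  alpha R n =
    if odd n then
      Num.sqrt ((n%:R ^+ 2 + 2 * n%:R - 1) / ((n%:R + 1) * (n%:R + 3)))
    else Num.sqrt (n%:R / (n%:R + 2)).
Proof.
have pos (k : nat) : (0 <= k%:R :> R)%R by exact: ler0n.
have := odd_double_half n; set h := n./2; rewrite -addnn.
case: (odd n) => /= <-.
  have -> : (1 + (h + h) = h + h.+1)%N by lia.
  rewrite alpha_balanced; last by lia.
  congr Num.sqrt; rewrite natrD -!natr1; have := pos h.
  move: (h%:R : R) => x x0; field.
  by do ?[apply/andP; split]; apply: lt0r_neq0; lra.
have -> : (0 + (h + h) = h + h)%N by lia.
rewrite alpha_balanced; last by lia.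
congr Num.sqrt; rewrite natrD -!natr1; have := pos h.
move: (h%:R : R) => x x0; field.
by do ?[apply/andP; split]; apply: lt0r_neq0; lra.
Qed.
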